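(* Let $b\in\mathbb{R}^n\setminus\mathbb{Z}^n$. The affine hull of $I_b$ in $\mathbb{R}^{(\mathbb{R}^n)}$ is described by the equations $$\sum_{p\in\mathbb{R}^n}\theta(p)y(p)=\theta(b)$$ for all additive functions $\theta:\mathbb{R}^n\to\mathbb{R}$ such that $\theta(p)=0$ for every $p\in\mathbb{Q}^n$; that is, $\operatorname{aff}(I_b)$ is the set of all $y\in\mathbb{R}^{(\mathbb{R}^n)}$ satisfying all of these equations.
   Context: $\mathbb{R}^{(\mathbb{R}^n)}$ is the real vector space of functions $\mathbb{R}^n\to\mathbb{R}$ with finite support. $I_b$ is the set of finite-support functions $y:\mathbb{R}^n\to\mathbb{Z}_+$ such that $\sum_{p\in\mathbb{R}^n}p\,y(p)\in b+\mathbb{Z}^n$. $\operatorname{aff}(C)$ denotes the set of (finite) affine combinations of points of $C$. A function $\theta:\mathbb{R}^n\to\mathbb{R}$ is additive if $\theta(u+v)=\theta(u)+\theta(v)$ for all $u,v\in\mathbb{R}^n$. *)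

(* Defs.v *)
From HB Require Import structures.
From mathcomp Require Import all_boot all_order all_algebra archimedean.
From mathcomp Require Import boolp classical_sets functions cardinality fsbigop.
From mathcomp Require Import reals.

Set Implicit Arguments.
Unset Strict Implicit.
Unset Printing Implicit Defensive.

Import Order.TTheory GRing.Theory Num.Theory.

Local Open Scope classical_set_scope.
Local Open Scope ring_scope.

Section AffineHull.
Context {K : pzRingType} {V : lmodType K}.

Definition affine_hull (C : set V) : set V :=
  [set v | exists (k : nat) (c : 'I_k -> V) (a : 'I_k -> K),
    [/\ forall i, C (c i), \sum_(i < k) a i = 1 & v = \sum_(i < k) a i *: c i]].

End AffineHull.

Section FiniteSupport.
Context {R : realType} {n : nat}.
Implicit Types (b p : 'rV[R]_n) (y : 'rV[R]_n -> R).

Definition int_vectors : set 'rV[R]_n :=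
  [set p | forall j, p 0 j \is a Num.int].

Definition rat_vectors : set 'rV[R]_n :=
  [set p | forall j, rational (p 0 j)].

(* R^(R^n), as a subspace of the module of all functions R^n -> R; affine
   combinations of its elements can be taken in either space. *)
Definition fin_supp_fun : set ('rV[R]_n -> R) :=
  [set y | finite_set [set p | y p != 0]].

(* I_b: since y has finite support, the sum over [set: 'rV[R]_n] ranges over the
   support of p |-> y p *: p.  Members are real-valued functions taking values
   in Num.nat, so that I_b is a subset of R^(R^n). *)
Definition infinite_relaxation b : set ('rV[R]_n -> R) :=
  [set y | [/\ fin_supp_fun y,
               forall p, y p \is a Num.nat &
               exists2 z, int_vectors z &
                 \sum_(p \in [set: 'rV[R]_n]) y p *: p = b + z]].

End FiniteSupport.

(* Main.v *)
(* For y in I_b and an admissible theta, additivity turns the equation into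
   theta(b + z) = theta(b) with z integral.  Conversely, let e_p be the indicator
   of p.  The translate L = aff(I_b) - e_b is a linear subspace; if y - e_b were
   not in L, a linear functional f would vanish on L and send y - e_b to 1.  Then
   theta(p) = f(e_p) is additive, since both e_u + e_v + e_(b-u-v) and
   e_(u+v) + e_(b-u-v) lie in I_b, and it vanishes at rational q, since
   e_b + D e_q lies in I_b when D is a common denominator of q.  But
   sum theta(p) y(p) - theta(b) = f(y - e_b) = 1, so y violates the equation of
   theta. *)
Require Import Defs.
From HB Require Import structures.
From mathcomp Require Import all_boot all_order all_algebra archimedean.
From mathcomp Require Import boolp classical_sets functions cardinality fsbigop.
From mathcomp Require Import reals.

Set Implicit Arguments.
Unset Strict Implicit.
Unset Printing Implicit Defensive.

Import Order.TTheory GRing.Theory Num.Theory.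

Local Open Scope classical_set_scope.
Local Open Scope ring_scope.

(** * Separation of a vector from a subspace by a linear functional *)

Section Subspaces.
Context {K : fieldType} {V : lmodType K}.
Implicit Types (L : set V) (u v w : V).

Definition is_subspace L : Prop :=
  L 0 /\ forall a u w, L u -> L w -> L (a *: u + w).

(** Zorn's lemma: two vectors from a chain already lie in one of its members, so unions of chains
    stay subspaces that miss [v]. *)
Lemma maximal_subspace_avoiding L v : is_subspace L -> ~ L v ->
  exists M, [/\ is_subspace M, L `<=` M, ~ M v &
    forall N, is_subspace N -> M `<` N -> N v].
Proof.
move=> [L0 Llin] Lv.
(* The union with L makes the empty chain harmless in Zorn's lemma. *)
pose P A := is_subspace (A `|` L) /\ ~ (A `|` L) v.
have [F FP Ftot|M [[Msub Mv] Mmax]] := @Zorn_bigcup V P.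
  split; first split; first by right.
    have FL X u : F X -> (X `|` L) u -> (\bigcup_(X in F) X `|` L) u.
      by move=> FX [Xu|Lu]; [left; exists X | right].
    move=> a u w [[X FX Xu]|Lu] [[Y FY Yw]|Lw].
    - have [XY|YX] := Ftot X Y FX FY.
        by apply: (FL Y) => //; apply: (FP Y FY).1.2; left => //; exact: XY.
      by apply: (FL X) => //; apply: (FP X FX).1.2; left => //; exact: YX.
    - by apply: (FL X) => //; apply: (FP X FX).1.2; [left|right].
    - by apply: (FL Y) => //; apply: (FP Y FY).1.2; [right|left].
    - by right; exact: Llin.
  move=> [[X FX Xv]|//]; by apply: (FP X FX).2; left.
(* A subspace [N] above this union absorbs [L]; if it missed [v], it would satisfy [P] and
   contradict the maximality of [M]. *)
exists (M `|` L); split=> // N Nsub [MN NM].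
apply: contrapT => Nv; have NE : N `|` L = N.
  by apply/seteqP; split=> [u [//|Lu]|u]; [apply: MN; right | left].
apply: (Mmax N); last by rewrite /P NE.
by split=> [u Mu|NM']; [apply: MN; left | apply: NM => u /NM'; left].
Qed.

(** A maximal subspace [M] avoiding [v] is a complement of the line through [v]; [f] reads off the
    coefficient of [v] modulo [M]. *)
Lemma linear_separation L v : is_subspace L -> ~ L v ->
  exists f : V -> K^o, [/\ linear f, forall u, L u -> f u = 0 & f v = 1].
Proof.
move=> /maximal_subspace_avoiding /[apply] -[M [[M0 Mlin] LM Mv Mmax]].
have MZ a u : M u -> M (a *: u) by move=> Mu; rewrite -[a *: u]addr0; exact: Mlin.
have MB u w : M u -> M w -> M (u - w).
  by move=> Mu Mw; rewrite addrC -scaleN1r; exact: Mlin.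
have Mdec x : exists c : K, M (x - c *: v).
  apply: contrapT => /forallNP xv.
  (* If no [c] worked, the span of [x] and [M] would properly contain [M], hence contain
     [v = a *: x + w]; then [a] is nonzero and [c = a^-1] works after all. *)
  have [||a [w Mw vE]] := Mmax [set u | exists a : K, exists2 w, M w & u = a *: x + w].
  - split; first by exists 0, 0 => //; rewrite scale0r addr0.
    move=> a _ _ [c [u Mu ->]] [d [w Mw ->]].
    exists (a * c + d), (a *: u + w); first exact: Mlin.
    by rewrite scalerDr scalerA scalerDl addrACA.
  - split=> [u Mu|NM]; first by exists 0, u => //; rewrite scale0r add0r.
    apply: (xv 0); rewrite scale0r subr0; apply: NM.
    by exists 1, 0 => //; rewrite scale1r addr0.
  have a0 : a != 0.
    by apply: contra_notN Mv => /eqP a0; rewrite vE a0 scale0r add0r.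
  apply: (xv a^-1); rewrite vE scalerDr scalerA mulVf// scale1r.
  by rewrite opprD addrA subrr add0r -scaleNr; exact: MZ.
have Mcoef c : M (c *: v) -> c = 0.
  move=> Mcv; apply: contra_notP Mv => /eqP c0.
  by rewrite -[v]scale1r -(mulVf c0) -scalerA; exact: MZ.
have [f fP] := choice Mdec.
(* Uniqueness of the coefficient makes the chosen [f] linear. *)
have fE c x : M (x - c *: v) -> f x = c.
  move=> Mc; apply/eqP; rewrite -subr_eq0; apply/eqP/Mcoef.
  have -> : (f x - c) *: v = (x - c *: v) - (x - f x *: v).
    by rewrite scalerBl opprB [RHS]addrC addrA subrK.
  exact: MB.
exists f; split=> [a u w|u Lu|].
- apply: fE; rewrite scalerDl -scalerA opprD addrACA -scalerBr; exact: Mlin.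
- by apply: fE; rewrite scale0r subr0; exact: LM.
- by apply: fE; rewrite scale1r subrr.
Qed.

End Subspaces.

(** * Affine hulls and their translates *)

Section AffineHullTheory.
Context {K : pzRingType} {V : lmodType K}.
Implicit Types (C : set V) (u v w : V).

Lemma sub_affine_hull C : C `<=` affine_hull C.
Proof.
move=> v Cv; exists 1, (fun=> v), (fun=> 1); split=> //.
  by rewrite big_ord1.
by rewrite big_ord1 scale1r.
Qed.

(** The coefficient sum [s] is left free so that sums and multiples of combinations are again
    combinations. *)
Let combination C (s : K) v := exists (k : nat) (c : 'I_k -> V) (a : 'I_k -> K),
  [/\ forall i, C (c i), \sum_(i < k) a i = s & v = \sum_(i < k) a i *: c i].

Let combinationD C s t u v :
  combination C s u -> combination C t v -> combination C (s + t) (u + v).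
Proof.
move=> [k [c [a [Cc <- ->]]]] [l [d [e [Cd <- ->]]]].
pose glue T (g : 'I_k -> T) (h : 'I_l -> T) (i : 'I_(k + l)) :=
  match fintype.split i with inl j => g j | inr j => h j end.
have glueL T g h i : @glue T g h (lshift l i) = g i.
  by rewrite /glue -/(unsplit (inl i)) unsplitK.
have glueR T g h i : @glue T g h (rshift k i) = h i.
  by rewrite /glue -/(unsplit (inr i)) unsplitK.
exists (k + l)%N, (glue V c d), (glue K a e); split.
- by move=> i; rewrite /glue; case: (fintype.split i).
- by rewrite big_split_ord /=; congr +%R; apply: eq_bigr => i _;
    rewrite ?glueL ?glueR.
- by rewrite big_split_ord /=; congr +%R; apply: eq_bigr => i _;
    rewrite ?glueL ?glueR.
Qed.

Let combinationZ C s t v : combination C s v -> combination C (t * s) (t *: v).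
Proof.
move=> [k [c [a [Cc <- ->]]]]; exists k, c, (fun i => t * a i); split=> //.
  by rewrite mulr_sumr.
by rewrite scaler_sumr; apply: eq_bigr => i _; rewrite scalerA.
Qed.

(** The coefficients add up to [a * (1 - 1) + 1 = 1]. *)
Lemma affine_hull_translate C a u v w : affine_hull C u -> affine_hull C v ->
  affine_hull C w -> affine_hull C (a *: (u - v) + w).
Proof.
move=> Cu Cv Cw.
have := combinationD (combinationZ a (combinationD Cu (combinationZ (-1) Cv))) Cw.
by rewrite mulr1 subrr mulr0 add0r scaleN1r.
Qed.

End AffineHullTheory.

Lemma affine_hull_subspace (K : fieldType) (V : lmodType K) (C : set V) (o : V) :
  C o -> is_subspace [set v | affine_hull C (v + o)].
Proof.
move=> /sub_affine_hull Co; split=> [/=|a u w /= Cu Cw]; first by rewrite add0r.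
by rewrite -[u in a *: u](addrK o) -addrA; exact: affine_hull_translate.
Qed.

(** * Finite multisets as finitely supported functions *)

Section Multiplicity.
Context {R : realType} {T : choiceType}.
Implicit Types (s : seq T) (p q : T) (y : T -> R).

(** In particular [multiplicity [:: p]] is the indicator of [p]. The codomain [R^o] gives these
    functions their module structure over [R]. *)
Definition multiplicity s : T -> R^o := fun q => (count_mem q s)%:R.

Lemma multiplicity_cons p s :
  multiplicity (p :: s) = multiplicity [:: p] + multiplicity s.
Proof. by apply/funext => q; rewrite /multiplicity !fctE/= addn0 natrD. Qed.

Lemma finite_support_multiplicity s : finite_set [set q | multiplicity s q != 0].
Proof.
apply: (sub_finite_set _ (finite_seq s)) => q /=.
by rewrite /multiplicity pnatr_eq0 -lt0n -has_count has_pred1.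
Qed.

Lemma sum_multiplicity (V : lmodType R) (F : T -> V) s :
  \sum_(q \in [set: T]) multiplicity s q *: F q = \sum_(p <- s) F p.
Proof.
rewrite (@fsbigE _ _ _ _ _ (undup s)) ?undup_uniq//.
  rewrite -[RHS]big_undup_iterop_count /=; apply: eq_big => // [q|q _].
    by rewrite in_setT.
  exact: scaler_nat.
move=> q _; rewrite mem_undup /multiplicity => /count_memPn ->.
by rewrite scale0r.
Qed.

Lemma finite_support_expansion y s : uniq s -> (forall p, p \notin s -> y p = 0) ->
  y = \sum_(p <- s) y p *: multiplicity [:: p] :> (T -> R^o).
Proof.
move=> s_uniq ys; apply/funext => q; rewrite fct_sumE.
have E p : (y p *: multiplicity [:: p]) q = if p == q then y q else 0.
  rewrite /multiplicity fctE/= addn0; case: eqVneq => [->|_].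
    exact: mulr1.
  exact: mulr0.
under eq_bigr do rewrite E.
have [qs|/[dup] qs /ys ->] := boolP (q \in s).
  by rewrite (bigD1_seq q)//= eqxx big1 ?addr0// => p /negPf ->.
by rewrite big1// => p _; case: ifP.
Qed.

Lemma finite_set_uniq_seq (A : set T) : finite_set A ->
  exists2 s, uniq s & forall p, p \notin s -> ~ A p.
Proof.
move=> /finite_seqP[s ->]; exists (undup s); first exact: undup_uniq.
by move=> p; rewrite mem_undup => /negP.
Qed.

End Multiplicity.

(** * Members of the relaxation given by lists of points *)

Section InfiniteRelaxation.
Context {R : realType} {n : nat}.
Implicit Types (b p q z : 'rV[R]_n) (s : seq 'rV[R]_n).

Lemma multiplicity_relaxation b s : int_vectors (\sum_(p <- s) p - b) ->
  infinite_relaxation b (multiplicity s).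
Proof.
move=> sb; split=> [|p|].
- exact: finite_support_multiplicity.
- exact: natr_nat.
- by exists (\sum_(p <- s) p - b) => //; rewrite addrC subrK sum_multiplicity.
Qed.

Lemma int_vectors0 : int_vectors (0 : 'rV[R]_n).
Proof. by move=> j; rewrite mxE. Qed.

Lemma int_rat_vectors p : int_vectors p -> rat_vectors p.
Proof.
move=> pint j; have /intrP[m ->] := pint j.
by exists m%:~R => //; rewrite ratr_int.
Qed.

Lemma rat_vectors_denominator q : rat_vectors q ->
  exists2 D, (0 < D)%N & int_vectors (q *+ D).
Proof.
move=> qrat; have /choice[r rE] : forall j, exists x : rat, ratr x = q 0 j.
  by move=> j; have [x _ <-] := qrat j; exists x.
(* The product of the coordinate denominators is a common denominator. *)
exists (\prod_j `|denq (r j)|)%N; first by rewrite prodn_gt0// => j; rewrite absz_gt0 denq_eq0.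
move=> j; rewrite mulmxnE -rE (bigD1 j)//= mulrnA rpredMn//.
rewrite -mulr_natr natr_absz normr_denq divfK ?intr_int//.
by rewrite intr_eq0 denq_eq0.
Qed.

Section Additive.
Variables (b : 'rV[R]_n) (theta : 'rV[R]_n -> R).
Hypothesis theta_relaxation : forall s, int_vectors (\sum_(p <- s) p - b) ->
  \sum_(p <- s) theta p = theta b.

Lemma relaxation_invariant_additive : {morph theta : u v / u + v}.
Proof.
(* Both lists sum to [b], and their common last entry cancels. *)
move=> u v; have := theta_relaxation (s := [:: u; v; b - (u + v)]).
have := theta_relaxation (s := [:: u + v; b - (u + v)]).
rewrite !big_cons !big_nil !addr0 !(addrA u v) (addrC (u + v)) subrK subrr.
move=> /(_ int_vectors0) <- /(_ int_vectors0) /esym.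
by rewrite addrA => /addIr.
Qed.

Lemma relaxation_invariant_rat q : rat_vectors q -> theta q = 0.
Proof.
move=> /rat_vectors_denominator[D D0 Dq].
have := theta_relaxation (s := b :: nseq D q).
rewrite !big_cons !big_nseq !iter_addr_0 addrAC subrr add0r => /(_ Dq).
move=> /(canRL (addKr _)) /eqP; rewrite addNr mulrn_eq0 gtn_eqF//.
exact: eqP.
Qed.

End Additive.
End InfiniteRelaxation.

(** * Validity of the equations on the relaxation *)

Section AdditiveEquations.
Context {R : realType} {n : nat}.
Variable theta : 'rV[R]_n -> R.
Hypothesis thetaD : {morph theta : u v / u + v}.
Hypothesis theta_rat : forall p, rat_vectors p -> theta p = 0.

(** Since [y] takes natural values, additivity of [theta] suffices to move it through the sum,
    without linearity over [R]. *)
Lemma additive_relaxation b y : infinite_relaxation b y ->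
  \sum_(p \in [set: 'rV[R]_n]) theta p * y p = theta b.
Proof.
have theta0 : theta 0 = 0 by exact/theta_rat/int_rat_vectors/int_vectors0.
have thetaMn p m : theta (p *+ m) = m%:R * theta p.
  elim: m => [|m IHm]; first by rewrite mulr0n theta0 mul0r.
  by rewrite mulrSr thetaD IHm [in RHS]mulrSr mulrDl mul1r.
move=> [/finite_set_uniq_seq[s s_uniq /= sP] ynat [z zint yz]].
have {}sP p : p \notin s -> y p = 0.
  by move=> /sP y0; apply/eqP; apply/negPn/negP.
rewrite (@fsbigE _ _ _ _ _ s)//; last by move=> p _ /sP ->; rewrite mulr0.
move: yz; rewrite (@fsbigE _ _ _ _ _ s)//; last by move=> p _ /sP ->; rewrite scale0r.
rewrite (eq_bigl xpredT) => [yz|p]; last by rewrite in_setT.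
rewrite (eq_bigl xpredT) => [|p]; last by rewrite in_setT.
have -> : theta b = theta (b + z).
  by rewrite thetaD (theta_rat (int_rat_vectors zint)) addr0.
rewrite -yz (big_morph theta thetaD theta0); apply: eq_bigr => p _.
by have /natrP[m ->] := ynat p; rewrite scaler_nat thetaMn mulrC.
Qed.

End AdditiveEquations.

Theorem proposition3p4 (R : realType) (n : nat) (b : 'rV[R]_n)
    (b_nonint : ~ int_vectors b) :
  affine_hull (V := 'rV[R]_n -> R^o) (infinite_relaxation b) =
  [set y : 'rV[R]_n -> R | fin_supp_fun y /\
    forall theta : 'rV[R]_n -> R,
      {morph theta : u v / u + v} ->
      (forall p, rat_vectors p -> theta p = 0) ->
      \sum_(p \in [set: 'rV[R]_n]) theta p * y p = theta b].
Proof.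
apply/seteqP; split=> [_ [k [c [a [cI a1 ->]]]]|y [yfin yeq]] /=.
  (* A list [s] covering the supports of all [c i] turns every sum into a finite one, so that the
     summations can be exchanged. *)
  have cfin : finite_set (\bigcup_(i in [set: 'I_k]) [set p | c i p != 0]).
    by apply: bigcup_finite => // i _; have [] := cI i.
  have [s s_uniq sP] := finite_set_uniq_seq cfin.
  have c0 i p : p \notin s -> c i p = 0.
    by move=> /sP cp; apply/eqP/negPn/negP => cip; apply: cp; exists i.
  have y0 p : p \notin s -> (\sum_(i < k) a i *: c i) p = 0.
    by move=> ps; rewrite fct_sumE big1// => i _; rewrite fctE c0// scaler0.
  split=> [|theta thetaD theta_rat].
    apply: sub_finite_set (finite_seq s) => p /=.
    by apply: contraNT => /y0 ->.
  have sumE (x : 'rV[R]_n -> R) : (forall p, p \notin s -> x p = 0) ->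
      \sum_(p \in [set: 'rV[R]_n]) theta p * x p = \sum_(p <- s) theta p * x p.
    move=> x0; rewrite (@fsbigE _ _ _ _ _ s)//.
      by apply: eq_bigl => p; rewrite in_setT.
    by move=> p _ /x0 ->; rewrite mulr0.
  rewrite sumE//.
  transitivity (\sum_(p <- s) \sum_(i < k) a i * (theta p * c i p)).
    apply: eq_bigr => p _; rewrite fct_sumE mulr_sumr.
    by apply: eq_bigr => i _; rewrite fctE mulrCA.
  rewrite exchange_big/= -[RHS]mul1r -a1 mulr_suml; apply: eq_bigr => i _.
  by rewrite -mulr_sumr -(additive_relaxation thetaD theta_rat (cI i)) sumE//; exact: c0.
set C := infinite_relaxation b.
have Cs s : int_vectors (\sum_(p <- s) p - b) -> C (multiplicity s).
  exact: multiplicity_relaxation.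
have Cb : C (multiplicity [:: b]).
  by apply: Cs; rewrite big_seq1 subrr; exact: int_vectors0.
apply: contrapT => yC.
(* This set is the translate of the affine hull that carries the indicator of [b] to the origin. *)
have yL : ~ [set v | affine_hull (V := 'rV[R]_n -> R^o) C (v + multiplicity [:: b])]
    (y - multiplicity [:: b]) by rewrite /= subrK.
have [f [flin fL f1]] := linear_separation (affine_hull_subspace Cb) yL.
pose F : {linear ('rV[R]_n -> R^o) -> R^o} :=
  HB.pack f (GRing.isLinear.Build _ _ _ _ f flin).
pose theta p : R := F (multiplicity [:: p]).
have F_mult s : F (multiplicity s) = \sum_(p <- s) theta p.
  elim: s => [|p s IHs]; last by rewrite multiplicity_cons linearD IHs big_cons.
  by rewrite big_nil -[RHS](linear0 F); congr (F _); apply/funext.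
(* [multiplicity s] differs from the indicator of [b] by an element of the subspace, where [F]
   vanishes. *)
have theta_C s : int_vectors (\sum_(p <- s) p - b) -> \sum_(p <- s) theta p = theta b.
  move=> /Cs/sub_affine_hull sC; apply/eqP; rewrite -F_mult -subr_eq0 -linearB.
  by apply/eqP/fL; rewrite /= subrK.
have [s s_uniq /= sP] := finite_set_uniq_seq yfin.
have y0 p : p \notin s -> y p = 0 by move=> /sP yp; apply/eqP/negPn/negP.
(* Expanding [y] in indicators turns [F y] into the left side of the equation of [theta]; then [F]
   sends [y - multiplicity [:: b]] to both 0 and 1. *)
have Fy : F y = theta b.
  rewrite -(yeq theta (relaxation_invariant_additive theta_C)
    (relaxation_invariant_rat theta_C)).
  rewrite (@fsbigE _ _ _ _ _ s)//; last by move=> p _ /y0 ->; rewrite mulr0.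
  rewrite [in LHS](finite_support_expansion s_uniq y0) linear_sum.
  apply: eq_big => [p|p _]; first by rewrite in_setT.
  by rewrite linearZ mulrC.
have : F (y - multiplicity [:: b]) = 1 by exact: f1.
by rewrite linearB Fy subrr => /esym/eqP; rewrite oner_eq0.
Qed.
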